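(* (The isolated extension theorem.) Let $T$ be a complete first-order theory in a (possibly multi-sorted) language $L$, and let $\varphi(\overline{x};\overline{y})$ be a partitioned $L$-formula. The following are equivalent: (i) $\varphi$ is dependent; (ii) for every model $M\models T$, every set $B$ of tuples from $M$ of the sort of $\overline{y}$, and every $\varphi$-type $p\in S_\varphi(B)$, there exists a $\varphi$-isolated elementary $\varphi$-extension $p'$ of $p$. Moreover, if these conditions hold, then for every such $M$, $B$ and $p\in S_\varphi(B)$ one can choose a $\varphi$-isolated elementary $\varphi$-extension $p'$ of $p$ with $|\mathrm{dom}(p')\setminus B|\le 2\cdot \mathrm{ID}(\varphi)$.
   Context: For a formula $\psi$, write $\psi^1=\psi$ and $\psi^0=\neg\psi$. A $\varphi$-type over a set $B$ (of tuples of the sort of $\overline{y}$) is a set $p(\overline{x})=\{\varphi(\overline{x};\overline{b})^{s(\overline{b})}:\overline{b}\in B\}$, for some $s:B\to\{0,1\}$, that is consistent with $T$ (together with the elementary diagram of the ambient model); $\mathrm{dom}(p)=B$ and $S_\varphi(B)$ is the set of all $\varphi$-types over $B$. A set $B$ is $\varphi$-independent if for every $s:B\to\{0,1\}$ the set $\{\varphi(\overline{x};\overline{b})^{s(\overline{b})}:\overline{b}\in B\}$ is consistent. $\mathrm{ID}(\varphi)=n<\omega$ if $n$ is maximal such that (in some, equivalently any, model of $T$) there is a $\varphi$-independent set of size $n$; $\varphi$ is dependent if such a finite $n$ exists. A $\varphi$-type $p$ is $\varphi$-isolated if there is a finite subset $p_0\subseteq p$ with $p_0\vdash p$. For $M\models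 T$ and $B$ a set of tuples from $M$ of the sort of $\overline{y}$, let $L_B=L\cup\{P_B\}$ with $P_B$ a new predicate in the sort of $\overline{y}$, and $(M;B)$ the $L_B$-structure interpreting $P_B$ as $B$. A $\varphi$-type $p'$ is an elementary $\varphi$-extension of $p\in S_\varphi(B)$ if $p\subseteq p'$ and $\mathrm{dom}(p')\subseteq B'$ for some $L_B$-elementary extension $(N;B')\succeq(M;B)$. *)

(* Defs.v *)
From mathcomp Require Import all_boot.
From mathcomp Require Import boolp classical_sets functions cardinality.

Set Implicit Arguments.
Unset Strict Implicit.
Unset Printing Implicit Defensive.

Local Open Scope classical_set_scope.
Local Open Scope card_scope.

Record language : Type := Language {
  lsort : Type;
  fsym : Type;
  fsym_dom : fsym -> seq lsort;
  fsym_cod : fsym -> lsort;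
  rsym : Type;
  rsym_dom : rsym -> seq lsort }.

Fixpoint tup (S : Type) (D : S -> Type) (ss : seq S) : Type :=
  if ss is s :: ss' then (D s * tup D ss')%type else unit.

Fixpoint tcat (S : Type) (D : S -> Type) (ss ss' : seq S) :
    tup D ss -> tup D ss' -> tup D (ss ++ ss') :=
  match ss return tup D ss -> tup D ss' -> tup D (ss ++ ss') with
  | [::] => fun _ b => b
  | s :: ss0 => fun a b => (a.1, tcat a.2 b)
  end.

Fixpoint tmap (S : Type) (D E : S -> Type) (f : forall s, D s -> E s)
    (ss : seq S) : tup D ss -> tup E ss :=
  match ss return tup D ss -> tup E ss with
  | [::] => fun _ => tt
  | s :: ss0 => fun a => (f s a.1, tmap f a.2)
  end.

(* Well-sorted de Bruijn syntax: a formula in the context [:: s1; ...; sn] has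
   its free variables among n variables of sorts s1, ..., sn. *)
Inductive var (S : Type) : seq S -> S -> Type :=
  | Var0 s ss : var (s :: ss) s
  | VarS s t ss : var ss s -> var (t :: ss) s.

Inductive term (L : language) (ctx : seq (lsort L)) : lsort L -> Type :=
  | Tvar s : var ctx s -> term ctx s
  | Tapp (g : fsym L) : terms ctx (fsym_dom g) -> term ctx (fsym_cod g)
with terms (L : language) (ctx : seq (lsort L)) : seq (lsort L) -> Type :=
  | Tnil : terms ctx [::]
  | Tcons s ss : term ctx s -> terms ctx ss -> terms ctx (s :: ss).

Inductive formula (L : language) (ctx : seq (lsort L)) : Type :=
  | Fbot : formula ctx
  | Feq s : term ctx s -> term ctx s -> formula ctx
  | Frel (r : rsym L) : terms ctx (rsym_dom r) -> formula ctx
  | Fimp : formula ctx -> formula ctx -> formula ctx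
  | Fall s : formula (s :: ctx) -> formula ctx.

Arguments formula : clear implicits.

Definition Fneg (L : language) (ctx : seq (lsort L)) (A : formula L ctx) :
  formula L ctx := Fimp A (Fbot ctx).

Notation sentence L := (formula L [::]).

Record structure (L : language) : Type := Structure {
  carrier :> lsort L -> Type;
  carrier_inhabited : forall s, inhabited (carrier s);
  fsym_interp : forall g : fsym L,
    tup carrier (fsym_dom g) -> carrier (fsym_cod g);
  rsym_interp : forall r : rsym L, set (tup carrier (rsym_dom r)) }.

Fixpoint lookup (S : Type) (D : S -> Type) (ctx : seq S) (s : S)
    (v : var ctx s) : tup D ctx -> D s :=
  match v in var ctx0 s0 return tup D ctx0 -> D s0 with
  | Var0 s ss => fun e => e.1
  | VarS s t ss v' => fun e => lookup v' e.2
  end.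

Fixpoint eval (L : language) (M : structure L) (ctx : seq (lsort L))
    (e : tup M ctx) (s : lsort L) (t : term ctx s) : M s :=
  match t in term _ s0 return M s0 with
  | Tvar s v => lookup v e
  | Tapp g ts => fsym_interp (evals e ts)
  end
with evals (L : language) (M : structure L) (ctx : seq (lsort L))
    (e : tup M ctx) (ss : seq (lsort L)) (ts : terms ctx ss) : tup M ss :=
  match ts in terms _ ss0 return tup M ss0 with
  | Tnil => tt
  | Tcons s ss t ts' => (eval e t, evals e ts')
  end.

Fixpoint sat (L : language) (M : structure L) (ctx : seq (lsort L))
    (A : formula L ctx) : tup M ctx -> Prop :=
  match A with
  | Fbot => fun _ => False
  | Feq s t u => fun e => eval e t = eval e u
  | Frel r ts => fun e => rsym_interp (evals e ts)
  | Fimp A1 A2 => fun e => sat A1 e -> sat A2 e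
  | Fall s A1 => fun e => forall a : M s, sat (ctx := s :: ctx) A1 (a, e)
  end.

Definition models (L : language) (M : structure L) (T : set (sentence L)) :
  Prop := forall A, T A -> sat (M := M) A tt.

Definition complete_theory (L : language) (T : set (sentence L)) : Prop :=
  (exists M : structure L, models M T) /\
  forall A : sentence L,
    (forall M : structure L, models M T -> sat (M := M) A tt) \/
    (forall M : structure L, models M T -> sat (M := M) (Fneg A) tt).

(* Elementary extensions are taken along embeddings rather than inclusions. *)
Definition elementary (L : language) (M N : structure L)
    (f : forall s, M s -> N s) : Prop :=
  forall (ctx : seq (lsort L)) (A : formula L ctx) (e : tup M ctx),
    sat A e <-> sat A (tmap f e).

Definition language_pred (L : language) (ys : seq (lsort L)) : language :=
  {| lsort := lsort L;
     fsym := fsym L;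
     fsym_dom := @fsym_dom L;
     fsym_cod := @fsym_cod L;
     rsym := option (rsym L);
     rsym_dom := fun r => if r is Some r' then rsym_dom r' else ys |}.

Definition structure_pred (L : language) (ys : seq (lsort L))
    (M : structure L) (B : set (tup M ys)) : structure (language_pred ys) :=
  @Structure (language_pred ys) M (@carrier_inhabited L M)
    (@fsym_interp L M)
    (fun r => match r return set (tup M (@rsym_dom (language_pred ys) r)) with
              | Some r' => @rsym_interp L M r'
              | None => B
              end).

Section PhiTypes.
Variables (L : language) (T : set (sentence L)) (xs ys : seq (lsort L)).
Variable phi : formula L (xs ++ ys).

Definition phi_pow (t : bool) : formula L (xs ++ ys) :=
  if t then phi else Fneg phi.

(* The pair (b, t) stands for the formula phi(x; b)^t with parameters in M. *)
Definition instance (M : structure L) : Type := (tup M ys * bool)%type.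

Definition instance_map (M N : structure L) (f : forall s, M s -> N s)
  (i : instance M) : instance N := (tmap f i.1, i.2).

(* Models of T together with the elementary diagram of M: the constant naming
   m : M s is interpreted by f s m. *)
Definition diagram_model (M N : structure L)
    (f : forall s, M s -> N s) : Prop :=
  models N T /\ elementary f.

Definition realizes (M N : structure L) (f : forall s, M s -> N s)
    (a : tup N xs) (p : set (instance M)) : Prop :=
  forall i, p i -> sat (phi_pow i.2) (tcat a (tmap f i.1)).

Definition consistent (M : structure L) (p : set (instance M)) : Prop :=
  exists (N : structure L) (f : forall s, M s -> N s) (a : tup N xs),
    diagram_model f /\ realizes f a p.

Definition entails (M : structure L) (p q : set (instance M)) : Prop :=
  forall (N : structure L) (f : forall s, M s -> N s) (a : tup N xs),
    diagram_model f -> realizes f a p -> realizes f a q.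

(* Only the restriction of s to B matters. *)
Definition phi_set (M : structure L) (B : set (tup M ys))
  (s : tup M ys -> bool) : set (instance M) := [set (b, s b) | b in B].

Definition phi_type (M : structure L) (B : set (tup M ys)) :
    set (set (instance M)) :=
  [set p | (exists s, p = phi_set B s) /\ consistent p].

Definition phi_dom (M : structure L) (p : set (instance M)) :
  set (tup M ys) := [set i.1 | i in p].

Definition phi_independent (M : structure L) (B : set (tup M ys)) : Prop :=
  forall s : tup M ys -> bool, consistent (phi_set B s).

Definition has_independent (n : nat) : Prop :=
  exists (M : structure L) (B : set (tup M ys)),
    [/\ models M T, B #= `I_n & phi_independent B].

(* ID(phi) = n *)
Definition ID_is (n : nat) : Prop :=
  has_independent n /\ forall m, has_independent m -> m <= n.

Definition dependent : Prop := exists n, ID_is n.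

Definition phi_isolated (M : structure L) (p : set (instance M)) : Prop :=
  exists p0 : set (instance M), [/\ finite_set p0, p0 `<=` p & entails p0 p].

Definition elementary_phi_extension (M : structure L) (B : set (tup M ys))
    (p : set (instance M)) (N : structure L) (f : forall s, M s -> N s)
    (p' : set (instance N)) : Prop :=
  [/\ phi_type (phi_dom p') p',
      instance_map f @` p `<=` p'
    & exists B' : set (tup N ys),
        @elementary (language_pred ys) (structure_pred B) (structure_pred B') f
        /\ phi_dom p' `<=` B'].

End PhiTypes.

(* Main.v *)
Require Import Defs.
From mathcomp Require Import all_boot.
From mathcomp Require Import boolp classical_sets functions cardinality filter.

(** Let p be a phi-type over B. All constructions happen in M, with a type over
    M finitely satisfiable in B replaced by an ultrafilter on B.

    Suppose pairs (c_i0, c_i1), i < k, realize such types and that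
    q = {phi(x; c_i1), ~ phi(x; c_i0) : i < k} is consistent with p. If no
    finite part of p, joined with q, entails p, then every finite part p0 comes
    with some b in B such that p0, q and the negation of the instance of p at b
    are consistent. An ultrafilter limit U of such b, along growing p0,
    concentrates on the b of one sign t. Take c |= U and then c' |= U over c:
    as p contains phi(x; b)^t for U-almost all b, p + q is consistent with
    phi(x; c)^(1-t) and phi(x; c')^t, which is pair number k.

    Both members of a pair realize the same coheir over the earlier ones, so
    the type of (c_(0,s(0)), ..., c_(k-1,s(k-1))) does not depend on s and
    c_00, ..., c_(k-1,0) is phi-independent. Hence k <= ID(phi): the process
    stops, and then p + q, read in an ultrapower of (M; B), is isolated.

    Conversely, if phi is not dependent, an ultraproduct contains an infinite
    phi-independent sequence B. If m instances over B' >= B isolated an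
    extension of a type over B, elementarity would turn them into m instances
    over B that entail m + 1 members of the type. *)

Set Implicit Arguments.
Unset Strict Implicit.
Unset Printing Implicit Defensive.

Local Open Scope classical_set_scope.
Local Open Scope card_scope.

(** * Lists and tuples *)

Fixpoint all_prop (X : Type) (P : X -> Prop) (l : seq X) : Prop :=
  if l is x :: l' then P x /\ all_prop P l' else True.

Lemma all_prop_impl (X : Type) (P Q : X -> Prop) (l : seq X) :
  (forall x, P x -> Q x) -> all_prop P l -> all_prop Q l.
Proof. by move=> PQ; elim: l => //= x l IH [/PQ ? /IH]. Qed.

Lemma all_prop_cat (X : Type) (P : X -> Prop) (l l' : seq X) :
  all_prop P (l ++ l') <-> all_prop P l /\ all_prop P l'.
Proof. by elim: l => [|x l IH] /=; [tauto|rewrite IH; tauto]. Qed.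

Lemma all_prop_catrev (X : Type) (P : X -> Prop) (l l' : seq X) :
  all_prop P (catrev l l') <-> all_prop P l /\ all_prop P l'.
Proof. by elim: l l' => [|x l IH] l' /=; [tauto|rewrite IH /=; tauto]. Qed.

Lemma all_prop_map (X Y : Type) (f : X -> Y) (P : Y -> Prop) (l : seq X) :
  all_prop P (map f l) <-> all_prop (fun x => P (f x)) l.
Proof. by elim: l => //= x l ->. Qed.

Lemma all_prop_iff (X : Type) (P Q : X -> Prop) (l : seq X) :
  (forall x, P x <-> Q x) -> all_prop P l <-> all_prop Q l.
Proof. by move=> PQ; split; apply: all_prop_impl => x /PQ. Qed.

Lemma all_prop_nth (X : Type) (P : X -> Prop) (d : X) (l : seq X) i :
  all_prop P l -> i < size l -> P (nth d l i).
Proof. by elim: l i => [|x l IH] [|i] //= [Px /IH]; auto. Qed.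

Lemma all_prop_nthP (X : Type) (P : X -> Prop) (d : X) (l : seq X) :
  all_prop P l <-> forall i, i < size l -> P (nth d l i).
Proof.
split=> [? i|]; first exact: all_prop_nth.
elim: l => //= x l IH H; split; first exact: (H 0).
by apply: IH => i; apply: (H i.+1).
Qed.

Lemma all_prop_mem (X : eqType) (P : X -> Prop) (l : seq X) x :
  all_prop P l -> x \in l -> P x.
Proof.
by elim: l => // y l IH /= [Py /IH H]; rewrite inE => /orP[/eqP->|/H].
Qed.

(** [{classic X}] provides decidable equality, so the finite set becomes a sequence. Characterizing
    the list by predicates spares later uses any membership test. *)
Lemma finite_set_list (X : Type) (A : set X) : finite_set A ->
  exists l : seq X, forall P : X -> Prop,
    all_prop P l <-> (forall x, A x -> P x).
Proof.
move=> /(@finite_seqP {classic X} A)[s ->]; exists s => P.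
elim: s => [|x s IH] /=; first by split.
rewrite IH; split=> [[Px Ps] y /=|H].
  by rewrite inE => /orP[/eqP->|/Ps].
by split=> [|y ys]; apply: H => /=; rewrite inE ?eqxx //; apply/orP; right.
Qed.

Section Tuples.
Variable S : Type.
Implicit Types (D E : S -> Type) (s : S) (ss : seq S).

Lemma tmap_comp D E (G : S -> Type) (f : forall s, D s -> E s)
    (g : forall s, E s -> G s) ss (a : tup D ss) :
  tmap g (tmap f a) = tmap (fun s x => g s (f s x)) a.
Proof. by elim: ss a => //= s ss IH a; rewrite IH. Qed.

Lemma tmap_ext D E (f g : forall s, D s -> E s) ss (a : tup D ss) :
  (forall s x, f s x = g s x) -> tmap f a = tmap g a.
Proof. by move=> fg; elim: ss a => //= s ss IH a; rewrite IH fg. Qed.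

Lemma tmap_id D ss (a : tup D ss) : tmap (fun s x => x) a = a.
Proof. by elim: ss a => [[]|s ss IH [x a]] //=; rewrite IH. Qed.

Lemma tmap_cat D E (f : forall s, D s -> E s) ss ss' (a : tup D ss)
    (b : tup D ss') : tmap f (tcat a b) = tcat (tmap f a) (tmap f b).
Proof. by elim: ss a => //= s ss IH a; rewrite IH. Qed.

Lemma lookup_tmap D E (f : forall s, D s -> E s) ss s (v : var ss s)
    (a : tup D ss) : lookup v (tmap f a) = f s (lookup v a).
Proof. by elim: v a => //= {}s t {}ss v IH a. Qed.

Lemma tup_inhabited D ss : (forall s, inhabited (D s)) -> inhabited (tup D ss).
Proof.
by move=> h; elim: ss => [|s ss [a]] /=; [|have [x] := h s]; constructor.
Qed.

(* A renaming of the variables of [ss] into a context [c] is a tuple of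
   variables [tup (var c) ss]; it acts on environments by [pull]. *)
Definition pull D c (e : tup D c) ss (v : tup (var c) ss) : tup D ss :=
  tmap (fun s w => lookup w e) v.

Fixpoint shift ss c s (v : var c s) : var (ss ++ c) s :=
  match ss with
  | [::] => v
  | t :: ss' => VarS t (shift ss' v)
  end.

Fixpoint varl ss c : tup (var (ss ++ c)) ss :=
  match ss return tup (var (ss ++ c)) ss with
  | [::] => tt
  | s :: ss' => (Var0 s (ss' ++ c), tmap (fun s v => VarS _ v) (varl ss' c))
  end.

Lemma lookup_shift D ss c s (v : var c s) (a : tup D ss) (e : tup D c) :
  lookup (shift ss v) (tcat a e) = lookup v e.
Proof. by elim: ss a => //= t ss IH a; rewrite IH. Qed.

Lemma pull_shift D ss c (a : tup D ss) (e : tup D c) ss' (v : tup (var c) ss') :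
  pull (tcat a e) (tmap (fun s w => shift ss w) v) = pull e v.
Proof. by rewrite /pull tmap_comp; apply: tmap_ext => s w; apply: lookup_shift. Qed.

Lemma pull_varl D ss c (a : tup D ss) (e : tup D c) :
  pull (tcat a e) (varl ss c) = a.
Proof.
elim: ss a => [[]|s ss IH [x a]] //; rewrite /pull /=; congr pair.
by rewrite -[RHS]IH /pull tmap_comp.
Qed.

Lemma pull_tmap D E (f : forall s, D s -> E s) c (e : tup D c) ss
    (v : tup (var c) ss) : pull (tmap f e) v = tmap f (pull e v).
Proof. by rewrite /pull tmap_comp; apply: tmap_ext => s w; rewrite lookup_tmap. Qed.

(** Elementarity concerns one formula in one environment. Concatenating all parameter tuples into
    [e] brings a finite list of instances within reach of a single formula in context [c]. *)
Lemma name_params D ss (l : seq (tup D ss * bool)) :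
  exists c (e : tup D c) (vs : seq (tup (var c) ss * bool)),
    l = [seq (pull e v.1, v.2) | v <- vs].
Proof.
elim: l => [|[b t] l [c [e [vs ->]]]]; first by exists [::], tt, [::].
exists (ss ++ c), (tcat b e),
  ((varl ss c, t) :: [seq (tmap (fun s w => shift ss w) v.1, v.2) | v <- vs]).
rewrite /= pull_varl -map_comp; congr cons; apply: eq_map => v /=.
by rewrite pull_shift.
Qed.

End Tuples.

(** * Renamings and finite conjunctions of instances *)

Scheme term_mut := Induction for term Sort Prop
  with terms_mut := Induction for terms Sort Prop.
Combined Scheme term_terms_ind from term_mut, terms_mut.

Fixpoint ren_term (L : language) (c c' : seq (lsort L)) (r : tup (var c') c)
    s (t : term c s) : term c' s :=
  match t in term _ s0 return term c' s0 with
  | Tvar s v => Tvar (lookup v r)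
  | Tapp g ts => Tapp (ren_terms r ts)
  end
with ren_terms (L : language) (c c' : seq (lsort L)) (r : tup (var c') c)
    ss (ts : terms c ss) : terms c' ss :=
  match ts in terms _ ss0 return terms c' ss0 with
  | Tnil => Tnil c'
  | Tcons s ss t ts' => Tcons (ren_term r t) (ren_terms r ts')
  end.

Definition lift_ren (S : Type) (c c' : seq S) s (r : tup (var c') c) :
  tup (var (s :: c')) (s :: c) :=
  (Var0 s c', tmap (fun _ v => VarS s v) r).

Fixpoint ren (L : language) (c : seq (lsort L)) (A : formula L c) :
    forall c', tup (var c') c -> formula L c' :=
  match A in formula _ _ return forall c', tup (var c') c -> formula L c' with
  | Fbot => fun c' r => Fbot c'
  | Feq s t u => fun c' r => Feq (ren_term r t) (ren_term r u)
  | Frel R ts => fun c' r => Frel (ren_terms r ts)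
  | Fimp A1 A2 => fun c' r => Fimp (ren A1 r) (ren A2 r)
  | Fall s A1 => fun c' r => Fall (ren (c := s :: c) A1 (lift_ren s r))
  end.

Lemma eval_ren (L : language) (M : structure L) (c c' : seq (lsort L))
    (r : tup (var c') c) (e : tup M c') :
  (forall s (t : term c s), eval e (ren_term r t) = eval (pull e r) t) /\
  (forall ss (ts : terms c ss), evals e (ren_terms r ts) = evals (pull e r) ts).
Proof.
apply: term_terms_ind => //= [s v|g ts ->//|s ss t -> ts ->//].
by rewrite /pull lookup_tmap.
Qed.

Lemma sat_ren (L : language) (M : structure L) (c : seq (lsort L))
    (A : formula L c) (c' : seq (lsort L)) (r : tup (var c') c) (e : tup M c') :
  sat (ren A r) e <-> sat A (pull e r).
Proof.
elim: A c' r e => {c} [c|c s t u|c R ts|c A1 IH1 A2 IH2|c s A1 IH] c' r e //=.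
- by rewrite !(proj1 (eval_ren r e)).
- by rewrite (proj2 (eval_ren r e)).
- by rewrite IH1 IH2.
- have E a : pull (c := s :: c') (ss := s :: c) (a, e) (lift_ren s r)
    = (a, pull e r) by rewrite /pull /= tmap_comp.
  by split=> H a; have := H a; rewrite IH E.
Qed.

(** * Conjunctions, blocks of quantifiers and instances *)

Definition Fand (L : language) (c : seq (lsort L)) (A A' : formula L c) :=
  Fneg (Fimp A (Fneg A')).

Fixpoint Falls (L : language) (xs c : seq (lsort L)) :
    formula L (xs ++ c) -> formula L c :=
  match xs return formula L (xs ++ c) -> formula L c with
  | [::] => fun A => A
  | s :: xs' => fun A => Falls (Fall (ctx := xs' ++ c) A)
  end.

Definition Fexs (L : language) (xs c : seq (lsort L)) (A : formula L (xs ++ c)) :=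
  Fneg (Falls (Fneg A)).

Lemma sat_neg (L : language) (M : structure L) (c : seq (lsort L))
    (A : formula L c) (e : tup M c) : sat (Fneg A) e <-> ~ sat A e.
Proof. by []. Qed.

Lemma sat_and (L : language) (M : structure L) (c : seq (lsort L))
    (A A' : formula L c) (e : tup M c) :
  sat (Fand A A') e <-> sat A e /\ sat A' e.
Proof.
split=> /=; last by move=> [? ?] H; apply: H.
by move=> H; split; apply: contrapT => H'; apply: H => ? ?; apply: H'.
Qed.

Lemma sat_alls (L : language) (M : structure L) (xs c : seq (lsort L))
    (A : formula L (xs ++ c)) (e : tup M c) :
  sat (Falls A) e <-> forall a : tup M xs, sat A (tcat a e).
Proof.
elim: xs A => [|s xs IH] A /=; first by split=> // H; apply: (H tt).
by rewrite IH; split=> [H [x a]|H a x]; [apply: H|apply: (H (x, a))].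
Qed.

Lemma sat_exs (L : language) (M : structure L) (xs c : seq (lsort L))
    (A : formula L (xs ++ c)) (e : tup M c) :
  sat (Fexs A) e <-> exists a : tup M xs, sat A (tcat a e).
Proof.
rewrite /Fexs /= sat_alls; split; last by move=> [a Aa] /(_ a)/=; apply.
by move=> H; apply: contrapT => /forallNP H'; apply: H => a /H'.
Qed.

Definition holds (L : language) (xs ys : seq (lsort L))
    (phi : formula L (xs ++ ys)) (M : structure L) (a : tup M xs)
    (i : instance ys M) : Prop :=
  sat (phi_pow phi i.2) (tcat a i.1).

Lemma holds_neg (L : language) (xs ys : seq (lsort L))
    (phi : formula L (xs ++ ys)) (M : structure L) (a : tup M xs)
    (b : tup M ys) (t : bool) :
  holds phi a (b, ~~ t) <-> ~ holds phi a (b, t).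
Proof.
case: t; rewrite /holds /=; first by [].
by split=> [? /(_ _)|/contrapT//]; apply.
Qed.

Section FiniteConjunctions.
Variables (L : language) (xs ys : seq (lsort L)) (phi : formula L (xs ++ ys)).

Fixpoint Fconj c (vs : seq (tup (var c) ys * bool)) : formula L (xs ++ c) :=
  if vs is v :: vs' then
    Fand (ren (phi_pow phi v.2)
            (tcat (varl xs c) (tmap (fun s w => shift xs w) v.1)))
         (Fconj vs')
  else Fneg (Fbot _).

Lemma sat_conj (M : structure L) c (vs : seq (tup (var c) ys * bool))
    (a : tup M xs) (e : tup M c) :
  sat (Fconj vs) (tcat a e) <->
  all_prop (holds phi a) [seq (pull e v.1, v.2) | v <- vs].
Proof.
elim: vs => [|v vs IH]; first by simpl; tauto.
rewrite [Fconj _]/= sat_and IH sat_ren /pull tmap_cat.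
by rewrite -!/(pull _ _) pull_varl pull_shift.
Qed.

Lemma pull_instance_map (M N : structure L) (f : forall s, M s -> N s) c
    (e : tup M c) (vs : seq (tup (var c) ys * bool)) :
  [seq (pull (tmap f e) v.1, v.2) | v <- vs] =
  map (instance_map f) [seq (pull e v.1, v.2) | v <- vs].
Proof. by rewrite -map_comp; apply: eq_map => v; rewrite /= pull_tmap. Qed.

(** Solvability of finitely many instances is one existential formula about their parameters, so it
    descends along an elementary map. *)
Lemma elementary_finite_reflect (M N : structure L) (f : forall s, M s -> N s)
    (l : seq (instance ys M)) (a : tup N xs) :
  elementary f -> all_prop (fun i => holds phi a (instance_map f i)) l ->
  exists a' : tup M xs, all_prop (holds phi a') l.
Proof.
move=> elf; have [c [e [vs ->]]] := name_params l; rewrite -all_prop_map => H.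
have /sat_exs[a' /sat_conj Ha'] : sat (Fexs (Fconj vs)) e.
  by apply/elf/sat_exs; exists a; apply/sat_conj; rewrite pull_instance_map.
by exists a'.
Qed.

(* "There are y_1, ..., y_m satisfying P such that the phi(x; y_i)^(t_i)
   together with l form a satisfiable set that implies z", where t_1, ..., t_m
   is the list ts. *)
Variable P : formula L ys.

Fixpoint Fisol c (ts : seq bool) (l z : seq (tup (var c) ys * bool)) :
    formula L c :=
  if ts is t :: ts' then
    Fexs (Fand (ren P (varl ys c))
      (Fisol ts'
        ((varl ys c, t) :: [seq (tmap (fun s w => shift ys w) v.1, v.2) | v <- l])
        [seq (tmap (fun s w => shift ys w) v.1, v.2) | v <- z]))
  else Fand (Fexs (Fconj l)) (Fneg (Fexs (Fand (Fconj l) (Fneg (Fconj z))))).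

(** The recursion puts each new witness at the head of [l], so the witnesses reach the final
    conjunction in reverse order; hence the [catrev]. *)
Lemma sat_isol (M : structure L) c (ts : seq bool)
    (l z : seq (tup (var c) ys * bool)) (e : tup M c) :
  sat (Fisol ts l z) e <->
  exists l' : seq (instance ys M),
    let q := catrev l' [seq (pull e v.1, v.2) | v <- l] in
    [/\ map snd l' = ts, all_prop (fun i => sat P i.1) l',
        exists a : tup M xs, all_prop (holds phi a) q
      & forall a : tup M xs, all_prop (holds phi a) q ->
          all_prop (holds phi a) [seq (pull e v.1, v.2) | v <- z]].
Proof.
elim: ts c l z e => [|t ts IH] c l z e; rewrite [Fisol _ _ _]/=.
  rewrite sat_and sat_neg !sat_exs; split.
    move=> [[a Ha] H]; exists [::]; split=> //=; first by exists a; apply/sat_conj.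
    move=> a' Ha'; apply: contrapT => H'; apply: H; exists a'.
    by rewrite sat_and sat_neg !sat_conj.
  move=> [[|i l'] []] // _ _ [a Ha] H; split; first by exists a; apply/sat_conj.
  by move=> [a']; rewrite sat_and sat_neg !sat_conj => -[/H].
have E (b : tup M ys) (w : seq (tup (var c) ys * bool)) :
    [seq (pull (tcat b e) v.1, v.2) |
      v <- [seq (tmap (fun s w => shift ys w) v.1, v.2) | v <- w]] =
    [seq (pull e v.1, v.2) | v <- w].
  by rewrite -map_comp; apply: eq_map => v /=; rewrite pull_shift.
rewrite sat_exs; split.
  move=> [b /sat_and[/sat_ren]]; rewrite pull_varl => Pb /IH[l'].
  rewrite [map _ (_ :: _)]/= !E pull_varl => -[<- Pl' H1 H2].
  by exists ((b, t) :: l').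
move=> [[|[b t'] l'] []] // [-> Ets] [Pb Pl'] H1 H2.
exists b; apply/sat_and; split; first by apply/sat_ren; rewrite pull_varl.
by apply/IH; exists l'; rewrite [map _ (_ :: _)]/= !E pull_varl.
Qed.

End FiniteConjunctions.

(** * Expansion by a predicate *)

Section Expansion.
Variables (L : language) (ys : seq (lsort L)).
Local Notation L' := (language_pred ys).

Fixpoint expand_term (c : seq (lsort L)) s (t : @term L c s) : @term L' c s :=
  match t in term _ s0 return @term L' c s0 with
  | Tvar s v => @Tvar L' c s v
  | Tapp g ts => @Tapp L' c g (expand_terms ts)
  end
with expand_terms (c : seq (lsort L)) ss (ts : @terms L c ss) :
    @terms L' c ss :=
  match ts in terms _ ss0 return @terms L' c ss0 with
  | Tnil => @Tnil L' c
  | Tcons s ss t ts' => @Tcons L' c s ss (expand_term t) (expand_terms ts')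
  end.

Fixpoint expand (c : seq (lsort L)) (A : formula L c) : formula L' c :=
  match A in formula _ _ with
  | Fbot => @Fbot L' c
  | Feq s t u => @Feq L' c s (expand_term t) (expand_term u)
  | Frel R ts => @Frel L' c (Some R) (expand_terms ts)
  | Fimp A1 A2 => Fimp (expand A1) (expand A2)
  | Fall s A1 => @Fall L' c s (expand (c := s :: c) A1)
  end.

Lemma eval_expand (M : structure L) (B : set (tup M ys)) c (e : tup M c) :
  (forall s (t : term c s),
    @eval L' (structure_pred B) c e s (expand_term t) = eval e t) /\
  (forall ss (ts : terms c ss),
    @evals L' (structure_pred B) c e ss (expand_terms ts) = evals e ts).
Proof. by apply: term_terms_ind => //= [g ts ->|s ss t -> ts ->]. Qed.

Lemma sat_expand (M : structure L) (B : set (tup M ys)) c (A : formula L c)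
    (e : tup M c) :
  @sat L' (structure_pred B) c (expand A) e <-> sat A e.
Proof.
elim: A e => {c} [c|c s t u|c R ts|c A1 IH1 A2 IH2|c s A1 IH] e //=.
- by rewrite !(proj1 (eval_expand B e)).
- by rewrite (proj2 (eval_expand B e)).
- by rewrite IH1 IH2.
- by split=> H a; apply/IH.
Qed.

Fixpoint var_terms (c ss : seq (lsort L)) : tup (var c) ss -> @terms L' c ss :=
  match ss return tup (var c) ss -> @terms L' c ss with
  | [::] => fun _ => @Tnil L' c
  | s :: ss' => fun v => @Tcons L' c s ss' (@Tvar L' c s v.1) (var_terms v.2)
  end.

Fixpoint id_vars (ss : seq (lsort L)) : tup (var ss) ss :=
  match ss return tup (var ss) ss with
  | [::] => tt
  | s :: ss' => (Var0 s ss', tmap (fun _ v => VarS s v) (id_vars ss'))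
  end.

Lemma pull_id_vars (D : lsort L -> Type) ss (e : tup D ss) :
  pull e (id_vars ss) = e.
Proof.
elim: ss e => [[]|s ss IH [x e]] //; rewrite /pull /=; congr pair.
by rewrite -[RHS]IH /pull tmap_comp.
Qed.

Definition Fpred : formula L' ys := @Frel L' ys None (var_terms (id_vars ys)).

Lemma evals_var_terms (N : structure L') c ss (v : tup (var c) ss)
    (e : tup N c) :
  evals (M := N) e (var_terms v) = pull e v.
Proof. by elim: ss v => [|s ss IH] v //=; rewrite IH. Qed.

Lemma sat_pred (M : structure L) (B : set (tup M ys)) (b : tup M ys) :
  @sat L' (structure_pred B) ys Fpred b <-> B b.
Proof. by rewrite /= (@evals_var_terms (structure_pred B)) pull_id_vars. Qed.

End Expansion.

(** * Ultraproducts *)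

Section Ultraproduct.
Variables (I : Type) (U : set_system I).
Hypothesis UU : UltraFilter U.

Lemma ultraC (A : set I) : U (~` A) <-> ~ U A.
Proof.
split; last by case: (in_ultra_setVsetC A UU).
move=> UCA UA; apply: (@filter_not_empty _ U _).
by rewrite -(setICr A); apply: filterI.
Qed.

Lemma ultra_imp (A B : set I) : U [set i | A i -> B i] <-> (U A -> U B).
Proof.
split=> [UAB UA|H]; first by apply: filterS2 UAB UA => i; apply.
case: (in_ultra_setVsetC A UU) => [/H|]; apply: filterS => i //= nA /nA.
Qed.

Lemma ultra_all_prop (X : Type) (P : I -> X -> Prop) (l : seq X) :
  all_prop (fun x => U [set i | P i x]) l -> U [set i | all_prop (P i) l].
Proof.
elim: l => [|x l IH] /=; first by move=> _; apply: filterE.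
by move=> [Ux /IH]; apply: filterS2 Ux.
Qed.

Section Family.
Variables (S : Type) (D : I -> S -> Type) (E : S -> Type)
  (cl : forall s, (forall i, D i s) -> E s).

Fixpoint tclass ss : (forall i, tup (D i) ss) -> tup E ss :=
  match ss return (forall i, tup (D i) ss) -> tup E ss with
  | [::] => fun _ => tt
  | s :: ss' => fun x => (cl (fun i => (x i).1), tclass (fun i => (x i).2))
  end.

Lemma tclass_cat ss ss' (x : forall i, tup (D i) ss)
    (y : forall i, tup (D i) ss') :
  tcat (tclass x) (tclass y) = tclass (fun i => tcat (x i) (y i)).
Proof. by elim: ss x => //= s ss IH x; rewrite IH. Qed.

Lemma lookup_tclass ss s (v : var ss s) (x : forall i, tup (D i) ss) :
  lookup v (tclass x) = cl (fun i => lookup v (x i)).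
Proof. by elim: v x => //= {}s t {}ss v IH x; rewrite IH. Qed.

Hypothesis cl_surj : forall s (y : E s), exists x, y = cl x.
Hypothesis cl_eq : forall s (x y : forall i, D i s),
  cl x = cl y <-> U [set i | x i = y i].

Lemma tclass_surj ss (y : tup E ss) : exists x, y = tclass x.
Proof.
elim: ss y => [|s ss IH] /=; first by case; exists (fun=> tt).
by move=> [y /IH[x' ->]]; have [x ->] := cl_surj y; exists (fun i => (x i, x' i)).
Qed.

Lemma tclass_eq ss (x y : forall i, tup (D i) ss) :
  tclass x = tclass y <-> U [set i | x i = y i].
Proof.
elim: ss x y => [|s ss IH] x y /=.
  by split=> // _; apply: filterE => i /=; case: (x i); case: (y i).
split=> [[/cl_eq U1 /IH U2]|Uxy].
  by apply: filterS2 U1 U2 => i /= E1 E2;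
    rewrite (surjective_pairing (x i)) E1 E2 -surjective_pairing.
by congr pair; [apply/cl_eq|apply/IH]; apply: filterS Uxy => i /= ->.
Qed.

End Family.

(* Stated for an arbitrary N because the expansion of [ultraproduct] by a
   predicate is not itself an [ultraproduct] up to conversion. *)
Record is_ultraproduct (L : language) (M : I -> structure L) (N : structure L)
    (cl : forall s, (forall i, M i s) -> N s) : Prop := IsUltraproduct {
  class_surj : forall s (y : N s), exists x, y = cl s x;
  class_eq : forall s (x y : forall i, M i s),
    cl s x = cl s y <-> U [set i | x i = y i];
  class_fsym : forall g (x : forall i, tup (M i) (fsym_dom g)),
    fsym_interp (tclass cl x) = cl _ (fun i => fsym_interp (x i));
  class_rsym : forall r (x : forall i, tup (M i) (rsym_dom r)),
    rsym_interp (tclass cl x) <-> U [set i | rsym_interp (x i)] }.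

Lemma class_eval (L : language) (M : I -> structure L) (N : structure L)
    (cl : forall s, (forall i, M i s) -> N s) c (e : forall i, tup (M i) c) :
  is_ultraproduct cl ->
  (forall s (t : term c s),
    eval (tclass cl e) t = cl s (fun i => eval (e i) t)) /\
  (forall ss (ts : terms c ss),
    evals (tclass cl e) ts = tclass cl (fun i => evals (e i) ts)).
Proof.
move=> H; apply: term_terms_ind => //= [s v|g ts ->|s ss t -> ts ->//].
  exact: lookup_tclass.
exact: class_fsym.
Qed.

Theorem Los (L : language) (M : I -> structure L) (N : structure L)
    (cl : forall s, (forall i, M i s) -> N s) c (A : formula L c)
    (e : forall i, tup (M i) c) :
  is_ultraproduct cl -> sat A (tclass cl e) <-> U [set i | sat A (e i)].
Proof.
move=> H; elim: A e => {c} [c|c s t u|c R ts|c A1 IH1 A2 IH2|c s A1 IH] e /=.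
- by split=> //; apply: filter_not_empty.
- by rewrite !(proj1 (class_eval _ H)) (class_eq H).
- by rewrite (proj2 (class_eval _ H)) (class_rsym H).
- by rewrite IH1 IH2 ultra_imp.
split=> [Hall|Uall y].
  apply: contrapT => /ultraC nU.
  (* [P i a] makes [a] a counterexample in [M i] whenever there is one. Such an [a] always exists,
     since carriers are inhabited, and the class of a choice of them refutes the universal
     formula. *)
  pose P i a := (~ forall a', @sat L (M i) (s :: c) A1 (a', e i)) ->
    ~ @sat L (M i) (s :: c) A1 (a, e i).
  have exP i : exists a, P i a.
    have [a] := carrier_inhabited (M i) s.
    case: (pselect (forall a, @sat L (M i) (s :: c) A1 (a, e i))) => [H'|].
      by exists a.
    by move=> /existsNP[a' na']; exists a'.
  pose x i := projT1 (cid (exP i)); have Hx i : P i (x i) := projT2 (cid (exP i)).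
  have /(IH (fun i => (x i, e i))) := Hall (cl s x).
  by apply/ultraC; apply: filterS nU => i /= /Hx.
have [x ->] := class_surj H y.
by apply/(IH (fun i => (x i, e i))); apply: filterS Uall => i /=; apply.
Qed.

(** * Construction of the ultraproduct *)

Section Construction.
Variables (L : language) (M : I -> structure L).

(** The class of [x] modulo equality on a [U]-large set. Kept as a set of families, it turns
    [ultra_carrier] into a genuine quotient. *)
Definition germ s (x : forall i, M i s) : set (forall i, M i s) :=
  [set y | U [set i | x i = y i]].

Definition ultra_carrier (s : lsort L) : Type :=
  {A : set (forall i, M i s) | exists x, A = germ x}.

Definition ultra_class s (x : forall i, M i s) : ultra_carrier s :=
  exist _ (germ x) (ex_intro _ x erefl).

Lemma ultra_class_surj s (y : ultra_carrier s) : exists x, y = ultra_class x.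
Proof. by case: y => A [x E]; exists x; apply: eq_exist. Qed.

Lemma ultra_class_eq s (x y : forall i, M i s) :
  ultra_class x = ultra_class y <-> U [set i | x i = y i].
Proof.
split=> [/(congr1 sval)/= E|Uxy].
  by have : germ x y by rewrite E; apply: filterE.
apply: eq_exist; apply/seteqP; split=> z; apply: filterS2 Uxy => i /=.
  by move=> ->.
by move=> ->.
Qed.

(** Symbols are interpreted through a chosen representative; by [ultra_repr_class] the choice
    matters only off a [U]-large set. *)
Definition ultra_repr ss (y : tup ultra_carrier ss) : forall i, tup (M i) ss :=
  projT1 (cid (tclass_surj ultra_class_surj y)).

Lemma ultra_reprK ss (y : tup ultra_carrier ss) :
  tclass ultra_class (ultra_repr y) = y.
Proof. by rewrite /ultra_repr; case: cid. Qed.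

Lemma ultra_repr_class ss (x : forall i, tup (M i) ss) :
  U [set i | ultra_repr (tclass ultra_class x) i = x i].
Proof. by apply/(tclass_eq ultra_class_eq); rewrite ultra_reprK. Qed.

Definition ultra_set ss (B : forall i, set (tup (M i) ss)) :
  set (tup ultra_carrier ss) := [set y | U [set i | B i (ultra_repr y i)]].

Lemma ultra_set_class ss (B : forall i, set (tup (M i) ss))
    (x : forall i, tup (M i) ss) :
  ultra_set B (tclass ultra_class x) <-> U [set i | B i (x i)].
Proof.
rewrite /ultra_set /=; split; apply: filterS2 (ultra_repr_class x) => i /= ->//.
Qed.

Lemma ultra_carrier_inhabited s : inhabited (ultra_carrier s).
Proof.
have h i : exists x : M i s, True by have [x] := carrier_inhabited (M i) s; exists x.
by constructor; apply: ultra_class => i; have [] := cid (h i).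
Qed.

Definition ultraproduct : structure L :=
  @Structure L ultra_carrier ultra_carrier_inhabited
    (fun g y => ultra_class (fun i => fsym_interp (ultra_repr y i)))
    (fun r => ultra_set (fun i => @rsym_interp L (M i) r)).

Lemma ultraproductP : @is_ultraproduct L M ultraproduct ultra_class.
Proof.
split=> [||g x|r x] /=.
- exact: ultra_class_surj.
- exact: ultra_class_eq.
- by apply/ultra_class_eq; apply: filterS (ultra_repr_class x) => i /= ->.
- exact: ultra_set_class.
Qed.

(** Expanding by a predicate commutes with ultraproducts. With constant families, [Los] in the
    larger language makes the diagonal map elementary from (M; B). *)
Lemma ultraproduct_predP (ys : seq (lsort L)) (B : forall i, set (tup (M i) ys)) :
  @is_ultraproduct (language_pred ys) (fun i => structure_pred (B i))
    (@structure_pred L ys ultraproduct (ultra_set B)) ultra_class.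
Proof.
split=> [||g x|[r|] x] /=.
- exact: ultra_class_surj.
- exact: ultra_class_eq.
- by apply/ultra_class_eq; apply: filterS (ultra_repr_class x) => i /= ->.
- exact: ultra_set_class.
- exact: ultra_set_class.
Qed.

Lemma ultraproduct_models (T : set (sentence L)) :
  (forall i, models (M i) T) -> models ultraproduct T.
Proof.
move=> MT A TA.
by apply/(Los A (fun=> tt) ultraproductP); apply: filterE => i; apply: MT.
Qed.

End Construction.

Lemma tclass_diag (L : language) (M : structure L) ss (b : tup M ss) :
  tmap (fun s x => @ultra_class L (fun=> M) s (fun=> x)) b =
  tclass (@ultra_class L (fun=> M)) (fun=> b).
Proof. by elim: ss b => //= s ss IH b; rewrite IH. Qed.

End Ultraproduct.

(** * Isolated extensions of types of a dependent formula *)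

Lemma filter_forall_lt (X : Type) (F : set_system X) (Q : nat -> set X) k :
  Filter F ->
  (forall i, i < k -> F (Q i)) <-> F [set x | forall i, i < k -> Q i x].
Proof.
move=> FF; split=> [|H i ik]; last by apply: filterS H => x; apply.
elim: k => [|k IH] H; first exact: filterE.
have := H k (ltnSn k); apply: filterS2 (IH (fun i ik => H i (ltnW ik))).
by move=> x Hx Qx i; rewrite ltnS leq_eqVlt => /orP[/eqP->|/Hx].
Qed.

(** * Iteration and images of ultrafilters *)

Lemma ultra_split (X : Type) (F : set_system X) : ProperFilter F ->
  (forall A, F A \/ F (~` A)) -> UltraFilter F.
Proof.
move=> FF FC; split=> // G GG FG; apply/seteqP; split=> // A GA.
case: (FC A) => // /FG GCA; exfalso; apply: (@filter_not_empty _ G _).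
by rewrite -(setICr A); apply: filterI.
Qed.

(** The bind of the filter monad; when [G x] lives on pairs with first entry [x] it is the Fubini
    product. It expresses that [y] realizes [G x] over a realization [x] of [F]. *)
Definition filter_bind (X Y : Type) (F : set_system X) (G : X -> set_system Y) :
  set_system Y := [set A | F [set x | G x A]].

Lemma ultra_bind (X Y : Type) (F : set_system X) (G : X -> set_system Y) :
  UltraFilter F -> (forall x, UltraFilter (G x)) -> UltraFilter (filter_bind F G).
Proof.
move=> UF UG; apply: ultra_split; last first.
  move=> A; case: (in_ultra_setVsetC [set x | G x A] UF); first by left.
  by move=> FC; right; apply: (@filterS _ F) FC => x /= nGA; apply/ultraC.
split.
  by move=> H; have [x /=] := @filter_ex _ F _ _ H; apply: filter_not_empty.
split=> [|A A'|A A' AA'].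
- by apply: (@filterE _ F) => x /=; apply: filterT.
- by apply: (@filterS2 _ F) => x /=; apply: filterI.
- by apply: (@filterS _ F) => x /=; apply: filterS.
Qed.

Definition filter_map (X Y : Type) (f : X -> Y) (F : set_system X) :
  set_system Y := [set A | F [set x | A (f x)]].

Lemma ultra_map (X Y : Type) (f : X -> Y) (F : set_system X) :
  UltraFilter F -> UltraFilter (filter_map f F).
Proof.
move=> UF; suff -> : filter_map f F = filter_bind F (fun x => principal_filter (f x)).
  by apply: ultra_bind => // x; apply: principal_filter_ultra.
apply/seteqP; split=> A /=; apply: (@filterS _ F) => x /=;
  by move=> ?; apply/principal_filterP.
Qed.

Lemma filter_cst (X : Type) (F : set_system X) (P : Prop) :
  ProperFilter F -> F [set _ | P] <-> P.
Proof. by move=> FF; split=> [/filter_ex[]//|?]; apply: filterE. Qed.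

Lemma elementary_id (L : language) (M : structure L) :
  elementary (fun s (x : M s) => x).
Proof. by move=> c A e; rewrite tmap_id. Qed.

Lemma realized_consistent (L : language) (T : set (sentence L))
    (xs ys : seq (lsort L)) (phi : formula L (xs ++ ys)) (M : structure L)
    (p : set (instance ys M)) (a : tup M xs) :
  models M T -> (forall i, p i -> holds phi a i) -> consistent T phi p.
Proof.
move=> MT Hp; exists M, (fun s x => x), a; split.
  by split=> //; apply: elementary_id.
by move=> i /Hp; rewrite tmap_id.
Qed.

(** * Sequences of pairs with opposite signs *)

Section IsolatedExtension.
Variables (L : language) (T : set (sentence L)) (xs ys : seq (lsort L)).
Variables (phi : formula L (xs ++ ys)) (M : structure L) (B : set (tup M ys)).
Variable sg : tup M ys -> bool.
Local Notation Y := (tup M ys).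

Definition signed (lb : seq Y) : seq (instance ys M) := [seq (b, sg b) | b <- lb].

(** This is the set q. In each pair the second member has sign [true] and the first has sign
    [false], in agreement with the convention of [select]. *)
Fixpoint pair_insts (M' : structure L) (z : seq (tup M' ys * tup M' ys)) :
    seq (instance ys M') :=
  if z is w :: z' then [:: (w.2, true), (w.1, false) & pair_insts z'] else [::].

Lemma size_pair_insts (M' : structure L) (z : seq (tup M' ys * tup M' ys)) :
  size (pair_insts z) = 2 * size z.
Proof. by elim: z => //= w z ->; rewrite mulnS. Qed.

Lemma pair_instsP (M' : structure L) (P : instance ys M' -> Prop) w0
    (z : seq (tup M' ys * tup M' ys)) :
  all_prop P (pair_insts z) <-> forall i, i < size z ->
    P ((nth w0 z i).2, true) /\ P ((nth w0 z i).1, false).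
Proof.
split; first by elim: z => [|w z IH] //= [H1 [H2 /IH H]] [|i] //; apply: H.
elim: z => [|w z IH] // H /=; have [H1 H2] := H 0 isT; do 2!split=> //.
by apply: IH => i; apply: (H i.+1).
Qed.

Fixpoint select (r : seq bool) (z : seq (Y * Y)) : seq Y :=
  match r, z with
  | t :: r', w :: z' => (if t then w.2 else w.1) :: select r' z'
  | _, _ => [::]
  end.

Lemma size_select (r : seq bool) z : size r = size z -> size (select r z) = size z.
Proof. by elim: z r => [|w z IH] [|t r] //= [/IH->]. Qed.

Lemma select_holds (r : seq bool) z (a : tup M xs) :
  all_prop (holds phi a) (pair_insts z) ->
  all_prop (holds phi a) (zip (select r z) r).
Proof.
by elim: z r => [|w z IH] [|[] r] //= [H1 [H2 /IH H]]; split.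
Qed.

(* F is the type over M of the sequence of pairs, the latest pair first. *)
Record pair_filter (k : nat) (F : set_system (seq (Y * Y))) : Prop := PairFilter {
  pair_filter_ultra : UltraFilter F;
  pair_filter_supp : F [set z | size z = k /\
                          all_prop (fun w => B w.1 /\ B w.2) z];
  pair_filter_sym : forall (r r' : seq bool) (A : set (seq Y)),
    size r = k -> size r' = k ->
    F [set z | A (select r z)] -> F [set z | A (select r' z)];
  pair_filter_sat : forall lb : seq Y, all_prop B lb ->
    F [set z | exists a : tup M xs,
                 all_prop (holds phi a) (signed lb ++ pair_insts z)] }.

(** A solution of q gives the members selected along [r] the signs [r]. Symmetry carries this
    pattern over to the selection of all first members. There are finitely many patterns, so one [z]
    serves all of them. *)
Lemma pair_filter_independent k F :
  models M T -> pair_filter k F -> has_independent T phi k.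
Proof.
move=> MT [UF Fs Fsym Fsat].
have FA (r : seq bool) : size r = k -> F [set z | exists a : tup M xs,
    all_prop (holds phi a) (zip (select (nseq k false) z) r)].
  move=> rk; pose A l := exists a : tup M xs, all_prop (holds phi a) (zip l r).
  apply: (Fsym r _ A) => //; first by rewrite size_nseq.
  by apply: filterS (Fsat [::] I) => z [a /(select_holds r)]; exists a.
have : F [set z | all_prop (fun r : k.-tuple bool => exists a : tup M xs,
    all_prop (holds phi a) (zip (select (nseq k false) z) r)) (enum {: k.-tuple bool})].
  apply: ultra_all_prop.
  by elim: (enum _) => //= r l IH; split=> //; apply: FA; rewrite size_tuple.
move=> /(filterI Fs)/filter_ex[z [[zk _] /= Hz]].
set l := select _ z in Hz.
have lk : size l = k by rewrite /l size_select ?size_nseq.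
have [d] := tup_inhabited ys (carrier_inhabited M).
have real (r : nat -> bool) : exists a : tup M xs,
    forall i, i < k -> holds phi a (nth d l i, r i).
  have /(_ [tuple r i | i < k])[|a Ha] := all_prop_mem Hz; first by rewrite mem_enum.
  exists a => i ik; have := all_prop_nth (d, false) Ha.
  move=> /(_ i); rewrite size_zip lk size_tuple minnn nth_zip ?size_tuple // => /(_ ik).
  by rewrite -(nth_mktuple (fun i : 'I_k => r i) false (Ordinal ik)).
exists M, [set nth d l i | i in `I_k]; split=> //.
  apply: inj_card_eq => i j; rewrite !inE /= => ik jk E.
  (* The pattern that is true at [i] only would give equal entries at [i] and [j] opposite signs. *)
  apply: contrapT => /eqP ij; have [a Ha] := real (fun m => m == i).
  have := Ha j jk; rewrite -E eq_sym (negPf ij).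
  by move/(holds_neg phi a _ true); apply; have := Ha i ik; rewrite eqxx.
move=> r; have [a Ha] := real (fun i => r (nth d l i)).
by apply: (realized_consistent (a := a)) => // _ [_ [i ik <-] <-]; apply: Ha.
Qed.

(** The large set may depend on [b]. This is enough to read in the ultrapower that [lb] and the
    pairs entail p, because there each [b] is tested separately. *)
Definition isolates (F : set_system (seq (Y * Y))) (lb : seq Y) : Prop :=
  all_prop B lb /\ forall b, B b -> F [set z | forall a : tup M xs,
    all_prop (holds phi a) (signed lb ++ pair_insts z) -> holds phi a (b, sg b)].

(** The lists over [B] that contain a given one form a cone, and concatenation bounds two lists, so
    the cones generate a proper filter. An ultrafilter above it decides the sign of [bt] and is then
    pushed forward along [bt]. *)
Lemma cofinal_ultrafilter (bt : seq Y -> Y) :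
  (forall lb, all_prop B lb -> B (bt lb)) ->
  exists (t : bool) (U : set_system Y),
    [/\ UltraFilter U, U [set b | B b /\ sg b = t] &
      forall (lb : seq Y) (A : set Y), all_prop B lb ->
        (forall lb', all_prop B lb' ->
           (forall P, all_prop P lb' -> all_prop P lb) -> A (bt lb')) -> U A].
Proof.
move=> Bbt.
(* Containment of lists is stated through predicates, so no decidable equality on tuples is
   required. *)
pose C lb : set (seq Y) := [set lb' | all_prop B lb' /\
  forall P, all_prop P lb' -> all_prop P lb].
have PF : ProperFilter (filter_from [set lb | all_prop B lb] C).
  apply: filter_from_proper; last by move=> lb Blb; exists lb; split.
  apply: filter_from_filter; first by exists [::].
  move=> l1 l2 B1 B2; exists (l1 ++ l2); first by apply/all_prop_cat.
  by move=> l [Bl Hl]; split; split=> // P /Hl/all_prop_cat[].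
have [G [UG sG]] := ultraFilterLemma PF.
have GB : G [set lb | B (bt lb)].
  by apply: sG; exists [::] => // lb [Blb _]; apply: Bbt.
have [t Gt] : exists t, G [set lb | sg (bt lb) = t].
  case: (in_ultra_setVsetC [set lb | sg (bt lb) = true] UG) => H.
    by exists true.
  by exists false; apply: filterS H => lb /= /negP/negPf.
exists t, (filter_map bt G); split; first exact: ultra_map.
  by apply: (@filterS2 _ G) GB Gt => lb.
move=> lb A Blb HA; apply: sG; exists lb => // lb' [Blb' H].
exact: HA.
Qed.

(* In the iterated quantifiers the outermost variable is the last one realized:
   c0 realizes U over c1, and c1 realizes U over the sequence z. *)
Definition extend_pairs (t : bool) (U : set_system Y)
    (F : set_system (seq (Y * Y))) : set_system (seq (Y * Y)) :=
  filter_bind U (fun c0 => filter_bind U (fun c1 =>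
    filter_map (cons (if t then (c1, c0) else (c0, c1))) F)).

Lemma extend_pairs_ultra t U F :
  UltraFilter U -> UltraFilter F -> UltraFilter (extend_pairs t U F).
Proof.
by move=> UU UF; do 2![apply: ultra_bind => // ?]; apply: ultra_map.
Qed.

(** Selecting one member of the new pair leaves the other quantifier vacuous, and the remaining
    variable realizes [U] over [z] in either case. The right side is thus free of [b], which is the
    source of the symmetry. *)
Lemma extend_pairs_select t U F (b : bool) r (A : set (seq Y)) :
  UltraFilter U ->
  extend_pairs t U F [set z | A (select (b :: r) z)] <->
  U [set c | F [set z | A (c :: select r z)]].
Proof.
move=> UU; rewrite /extend_pairs /filter_bind /filter_map /=.
case: t; case: b => /=; try exact: filter_cst.
- split; apply: filterS => c /=; first by move=> /filter_const.
  by move=> ?; apply: filterE.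
- split; apply: filterS => c /=; first by move=> /filter_const.
  by move=> ?; apply: filterE.
Qed.

Lemma pair_filter_step k F : pair_filter k F ->
  (exists lb, isolates F lb) \/ exists F', pair_filter k.+1 F'.
Proof.
move=> [UF Fs Fsym Fsat].
case: (pselect (exists lb, isolates F lb)); first by left.
move=> /forallNP nisol; right.
(* Failure of isolation by [lb] yields a [b] at which the negated instance is compatible with [lb]
   and the pairs. Putting the condition on [lb] inside makes the choice total. *)
have exb lb : exists b, all_prop B lb -> B b /\ F [set z | exists a : tup M xs,
    holds phi a (b, ~~ sg b) /\
    all_prop (holds phi a) (signed lb ++ pair_insts z)].
  case: (pselect (all_prop B lb)) => Blb; last first.
    by have [d] := tup_inhabited ys (carrier_inhabited M); exists d.
  have /existsNP[b /not_implyP[Bb /(ultraC UF) Fb]] := fun H => nisol lb (conj Blb H).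
  exists b => _; split=> //; apply: filterS Fb => z /existsNP[a /not_implyP[Ha nb]].
  by exists a; split=> //; apply/holds_neg.
pose bt lb := projT1 (cid (exb lb)).
have btP lb : all_prop B lb -> B (bt lb) /\ F [set z | exists a : tup M xs,
    holds phi a (bt lb, ~~ sg (bt lb)) /\
    all_prop (holds phi a) (signed lb ++ pair_insts z)] := projT2 (cid (exb lb)).
have [t [U [UU UB UC]]] := cofinal_ultrafilter (fun lb H => proj1 (btP lb H)).
have UF1 lb : all_prop B lb -> U [set c1 | F [set z | exists a : tup M xs,
    holds phi a (c1, ~~ t) /\ all_prop (holds phi a) (signed lb ++ pair_insts z)]].
  move=> Blb; have : U [set c1 | F [set z | exists a : tup M xs,
      holds phi a (c1, ~~ sg c1) /\
      all_prop (holds phi a) (signed lb ++ pair_insts z)]].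
    (* A solution for a longer list also solves [lb], so the property holds along the whole cone of
       [lb]. *)
    apply: (UC lb) => // lb' Blb' sub; have [_] := btP _ Blb'.
    apply: filterS => z [a [Ha]] /all_prop_cat[H1 H2]; exists a; split=> //.
    apply/all_prop_cat; split=> //; move: H1.
    by rewrite /signed !all_prop_map; apply: sub.
  by apply: filterS2 UB => c1 [_ E] /=; rewrite E.
exists (extend_pairs t U F); split; first exact: extend_pairs_ultra.
- apply: (@filterS _ U) (UB) => c0 [B0 _]; apply: (@filterS _ U) UB => c1 [B1 _].
  by apply: (@filterS _ F) Fs => z [/= -> Bz]; case: (t).
- move=> [//|b r] [//|b' r'] A [rk] [r'k]; rewrite !extend_pairs_select //.
  by apply: filterS => c; apply: (Fsym r r' (fun l => A (c :: l))).
- move=> lb Blb; apply: (@filterS _ U) UB => c0 [B0 s0].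
  (* Now [c0] is an element of [B] of sign [t]. Adding it to [lb] before [c1] is taken forces sign
     [t] at [c0], while [c1] receives the opposite sign. *)
  have := UF1 (c0 :: lb) (conj B0 Blb); apply: (@filterS _ U) => c1.
  apply: (@filterS _ F) => z [a [H1 /= [H0 H]]]; exists a; rewrite s0 in H0.
  move: H => /all_prop_cat[Hlb Hz]; apply/all_prop_cat; split=> //.
  by case: (t) H0 H1 => /=.
Qed.

(** * Termination and reading off the isolated extension *)

Hypothesis MT : models M T.
Hypothesis sat_p : forall lb : seq Y, all_prop B lb ->
  exists a : tup M xs, all_prop (holds phi a) (signed lb).

Lemma pair_filter0 : pair_filter 0 (principal_filter [::]).
Proof.
split; first exact: principal_filter_ultra.
- exact/principal_filterP.
- by move=> [|//] [|//].
- by move=> lb /sat_p[a Ha]; apply/principal_filterP; exists a; rewrite /= cats0.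
Qed.

Lemma isolating_pair_filter n : (forall m, has_independent T phi m -> m <= n) ->
  exists k F lb, [/\ k <= n, pair_filter k F & isolates F lb].
Proof.
move=> maxn; apply: contrapT => H.
suff [F pF] : exists F, pair_filter n.+1 F.
  by have := maxn _ (pair_filter_independent MT pF); rewrite ltnn.
(* The induction runs over all [k] up to [n.+1]. A step starts from at most [n] pairs, where
   isolation would contradict [H]. *)
elim: {-2}n.+1 (leqnn n.+1) => [_|k IH kn].
  by exists (principal_filter [::]); apply: pair_filter0.
have [F pF] := IH (ltnW kn).
by case: (pair_filter_step pF) => // -[lb Flb]; case: H; exists k, F, lb.
Qed.

(** In the ultrapower of [M] along [F], the classes of the coordinates of [z] form [k] generic
    pairs. Their [2 * k] instances join the image of p in [p']; together with the image of [lb] they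
    isolate it. *)
Lemma isolated_extension k F lb : pair_filter k F -> isolates F lb ->
  exists (N : structure L) (f : forall s, M s -> N s) (p' : set (instance ys N)),
    [/\ elementary_phi_extension T phi B (phi_set B sg) f p',
        phi_isolated T phi p'
      & (phi_dom p' `\` [set tmap f b | b in B]) #<= `I_(2 * k)].
Proof.
move=> [UF Fs _ Fsat] [Blb Hisol].
have [d] := tup_inhabited ys (carrier_inhabited M).
pose I := seq (Y * Y); pose N := ultraproduct F (fun=> M).
pose cl : forall s, (I -> M s) -> N s := @ultra_class _ F L (fun=> M).
pose f : forall s, M s -> N s := fun s x => cl s (fun=> x).
have NP : @is_ultraproduct I F L (fun=> M) N cl := ultraproductP UF (fun=> M).
have NT : models N T := ultraproduct_models UF (fun=> MT).
pose tcl ss (x : I -> tup M ss) : tup N ss := tclass (D := fun=> M) cl x.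
pose c0 j := tcl ys (fun z => (nth (d, d) z j).1).
pose c1 j := tcl ys (fun z => (nth (d, d) z j).2).
pose zc := mkseq (fun j => (c0 j, c1 j)) k.
have zck : size zc = k by rewrite size_mkseq.
have Los_holds (a : I -> tup M xs) (b : I -> Y) t :
    holds phi (tcl _ a) (tcl _ b, t) <-> F [set z | holds phi (a z) (b z, t)].
  rewrite /holds /= -(Los UF (phi_pow phi t) (fun z => tcat (a z) (b z)) NP).
  by rewrite /tcl tclass_cat.
have fE ss (b : tup M ss) : tmap f b = tcl ss (fun=> b) by apply: tclass_diag.
have Los_f (a : I -> tup M xs) (b : Y) t :
    holds phi (tcl _ a) (tmap f b, t) <-> F [set z | holds phi (a z) (b, t)].
  by rewrite fE Los_holds.
have zcP (P : instance ys N -> Prop) : all_prop P (pair_insts zc) <->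
    forall j, j < k -> P (c1 j, true) /\ P (c0 j, false).
  rewrite (pair_instsP _ (c0 0, c1 0)) zck.
  by split=> H j jk; have := H j jk; rewrite nth_mkseq.
have Los_pairs (a : I -> tup M xs) :
    all_prop (holds phi (tcl _ a)) (pair_insts zc) <->
    F [set z | all_prop (holds phi (a z)) (pair_insts z)].
  rewrite zcP; split=> H.
    have {}H j : j < k -> F [set z | holds phi (a z) ((nth (d, d) z j).2, true) /\
        holds phi (a z) ((nth (d, d) z j).1, false)].
      by move=> /H[/Los_holds H1 /Los_holds H2]; apply: filterI.
    move/filter_forall_lt in H; apply: filterS2 Fs H => z [zk _] /= H.
    by apply/(pair_instsP _ (d, d)); rewrite zk.
  move=> j jk; split; apply/Los_holds; apply: filterS2 Fs H => z [zk _] /=;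
    by move=> /(pair_instsP _ (d, d)); rewrite zk => /(_ j jk)[].
have elemB : @elementary (language_pred ys) (structure_pred B)
    (@structure_pred L ys N (ultra_set (fun=> B))) f.
  move=> c A e; rewrite fE.
  have := Los UF A (fun=> e) (ultraproduct_predP UF (fun=> B)).
  by rewrite filter_cst => H; symmetry.
pose i0 : instance ys N := (c0 0, true).
pose p' : set (instance ys N) := (instance_map f @` phi_set B sg) `|`
  [set nth i0 (pair_insts zc) j | j in `I_(2 * k)].
have p'P (P : instance ys N -> Prop) : (forall i, p' i -> P i) <->
    (forall b, B b -> P (tmap f b, sg b)) /\ all_prop P (pair_insts zc).
  rewrite (all_prop_nthP _ i0) size_pair_insts zck; split.
    move=> H; split=> [b Bb|j jk]; apply: H; last by right; exists j.
    by left; exists (b, sg b) => //; exists b.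
  by move=> [H1 H2] _ [[_ [b Bb <-] <-]|[j jk <-]]; [apply: H1|apply: H2].
(* A solution is picked wherever there is one, which is [F]-almost everywhere; its class realizes
   [p']. *)
have exa z : exists a : tup M xs,
    (exists a', all_prop (holds phi a') (signed lb ++ pair_insts z)) ->
    all_prop (holds phi a) (signed lb ++ pair_insts z).
  case: (pselect (exists a' : tup M xs,
    all_prop (holds phi a') (signed lb ++ pair_insts z))).
    by move=> [a Ha]; exists a.
  by move=> H; have [a] := tup_inhabited xs (carrier_inhabited M); exists a.
have [a Ha] := choice exa.
have Fa : F [set z | all_prop (holds phi (a z)) (signed lb ++ pair_insts z)].
  by apply: filterS (Fsat lb Blb) => z /Ha.
have ap' : forall i, p' i -> holds phi (tcl _ a) i.
  apply/p'P; split.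
    by move=> b Bb; apply/Los_f; apply: filterS2 Fa (Hisol b Bb) => z ? ; apply.
  by apply/Los_pairs; apply: filterS Fa => z /all_prop_cat[].
exists N, f, p'; split.
- split.
  + split; last by apply: realized_consistent ap'.
    (* Since [p'] is realized, no tuple carries both signs, and the sign function can be read off
       the realization. *)
    have E b t : p' (b, t) -> `[< holds phi (tcl _ a) (b, true) >] = t.
      case: t => /ap' H; first exact/asboolP.
      by apply/asboolPn; apply/(holds_neg phi _ _ true).
    exists (fun b => `[< holds phi (tcl _ a) (b, true) >]).
    apply/seteqP; split=> -[b t].
      by move=> pbt; exists b; [exists (b, t)|rewrite (E _ t)].
    by move=> [_ [[b' t'] pbt <-] [<- <-]] /=; rewrite (E _ t').
  + by move=> i pi; left.
  + exists (ultra_set (fun=> B)); split=> //.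
    suff H : forall i, p' i -> ultra_set (fun=> B) i.1 by move=> _ [i /H ? <-].
    apply/p'P; split=> [b Bb|].
      by rewrite fE; apply/(ultra_set_class UF); apply: filterE.
    apply/zcP => j jk; split; apply/(ultra_set_class UF); apply: filterS Fs => z [zk];
      by move=> /(all_prop_nthP _ (d, d)); rewrite zk => /(_ j jk)[].
- pose l0 := [seq instance_map f i | i <- signed lb] ++ pair_insts zc.
  exists [set nth i0 l0 j | j in `I_(size l0)]; split.
  + exact/finite_image/finite_II.
  + have : all_prop p' l0.
      apply/all_prop_cat; split; last exact: (proj2 (proj1 (p'P p') _)).
      rewrite !all_prop_map; apply: all_prop_impl Blb => b Bb.
      exact: (proj1 (proj1 (p'P p') _)).
    by move=> /(all_prop_nthP _ i0) H _ [j jk <-]; apply: H.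
  + move=> N' g a' [_ elg] ra'.
    have Hl0 : all_prop (fun i => holds phi a' (instance_map g i)) l0.
      by apply/(all_prop_nthP _ i0) => j jk; apply: ra'; exists j.
    apply/p'P; split; last by case/all_prop_cat: Hl0.
    move=> b Bb; apply: contrapT => nb.
    (* A failure of entailment at [b] involves finitely many instances. It descends from [N'] to
       [N], then by Los to a single [z], where it contradicts [Hisol]. *)
    have [] := @elementary_finite_reflect _ _ _ phi N N' g
      ((tmap f b, ~~ sg b) :: l0) a' elg.
      by split=> //; apply/(holds_neg phi a' (tmap g (tmap f b)) (sg b)).
    move=> e [eb /all_prop_cat[elb ez]].
    have [x ex] := tclass_surj (class_surj NP) e; move: eb elb ez; rewrite ex.
    move=> /Los_f Fb Flb /Los_pairs Fz.
    have {}Flb : F [set z | all_prop (holds phi (x z)) (signed lb)].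
      apply: ultra_all_prop; move: Flb; rewrite !all_prop_map.
      by apply: all_prop_impl => b' /Los_f.
    have [z [Hb [Hz [Hl Hi]]]] :=
      filter_ex (filterI Fb (filterI Fz (filterI Flb (Hisol b Bb)))).
    by move: Hb => /holds_neg; apply; apply: Hi; apply/all_prop_cat.
apply: card_le_trans (subset_card_le _) (card_image_le
  (fun j => (nth i0 (pair_insts zc) j).1) `I_(2 * k)).
move=> _ [[_ [[_ [b Bb <-] <-]|[j jk <-]] <-]] nB; last by exists j.
by case: nB; exists b.
Qed.

End IsolatedExtension.

(** * Independent formulas *)

Lemma elementary_models (L : language) (T : set (sentence L))
    (M N : structure L) (f : forall s, M s -> N s) :
  elementary f -> models N T -> models M T.
Proof. by move=> elf NT A TA; apply/(elf _ A tt)/NT. Qed.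

Lemma consistent_finite (L : language) (T : set (sentence L))
    (xs ys : seq (lsort L)) (phi : formula L (xs ++ ys)) (M : structure L)
    (p : set (instance ys M)) (l : seq (instance ys M)) :
  consistent T phi p -> all_prop p l ->
  exists a : tup M xs, all_prop (holds phi a) l.
Proof.
move=> [N [f [a [[_ elf] ra]]]] pl.
apply: (elementary_finite_reflect (a := a) elf).
by apply: all_prop_impl pl => i /ra.
Qed.

Lemma has_independent0 (L : language) (T : set (sentence L))
    (xs ys : seq (lsort L)) (phi : formula L (xs ++ ys)) (M : structure L) :
  models M T -> has_independent T phi 0.
Proof.
move=> MT; exists M, set0; split=> //; first by rewrite II0; apply: card_eq00.
move=> s; have [a] := tup_inhabited xs (carrier_inhabited M).
by apply: (realized_consistent (a := a)) => // i [].
Qed.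

(** A nonempty bounded set of sizes has a maximum, which would be ID; size 0 gives nonemptiness. *)
Lemma not_dependent_unbounded (L : language) (T : set (sentence L))
    (xs ys : seq (lsort L)) (phi : formula L (xs ++ ys)) :
  has_independent T phi 0 -> ~ dependent T phi ->
  forall m, exists2 m', m <= m' & has_independent T phi m'.
Proof.
move=> h0 ndep m; apply: contrapT => H; apply: ndep.
have ex0 : exists k, `[< has_independent T phi k >] by exists 0; apply/asboolP.
have bd k : `[< has_independent T phi k >] -> k <= m.
  move=> /asboolP hk; rewrite leqNgt; apply/negP => mk; apply: H.
  by exists k => //; apply: ltnW.
by case: (ex_maxnP ex0 bd) => n /asboolP hn maxn; exists n; split=> // k hk;
  apply/maxn/asboolP.
Qed.

Lemma independent_enum (L : language) (T : set (sentence L))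
    (xs ys : seq (lsort L)) (phi : formula L (xs ++ ys)) m :
  has_independent T phi m ->
  exists (M : structure L) (b : nat -> tup M ys), models M T /\
    forall r : nat -> bool, exists a : tup M xs,
      forall j, j < m -> holds phi a (b j, r j).
Proof.
move=> [M [B [MT /pcard_eqP/bijPex[h [_ _ hsurj]] indB]]].
have [d] := tup_inhabited ys (carrier_inhabited M).
have exb j : exists b, j < m -> B b /\ h b = j.
  have [jm|jm] := ltnP j m; last by exists d.
  by have [b Bb <-] := hsurj j jm; exists b.
have [b Hb] := choice exb; exists M, b; split=> // r.
have [|a Ha] := consistent_finite (l := mkseq (fun j => (b j, r j)) m)
  (indB (fun c => r (h c))).
  apply/(all_prop_nthP _ (d, true)); rewrite size_mkseq => j jm.
  by rewrite nth_mkseq //; have [Bb hb] := Hb j jm; exists (b j); rewrite ?hb.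
exists a => j jm.
have := all_prop_nth (d, true) Ha; rewrite size_mkseq => /(_ j jm).
by rewrite nth_mkseq.
Qed.

(** The ultrafilter contains all final segments of the indices. For a fixed [r] the solutions in the
    factors have a class that solves every condition at once, so one model realizes all infinite
    sign patterns. *)
Lemma independent_sequence (L : language) (T : set (sentence L))
    (xs ys : seq (lsort L)) (phi : formula L (xs ++ ys)) :
  (forall m, exists2 m', m <= m' & has_independent T phi m') ->
  exists (M : structure L) (b : nat -> tup M ys), models M T /\
    forall r : nat -> bool, exists a : tup M xs,
      forall j, holds phi a (b j, r j).
Proof.
move=> unb.
have exM m : exists Mb : {M : structure L & nat -> tup M ys},
    models (projT1 Mb) T /\ forall r : nat -> bool,
      exists a : tup (projT1 Mb) xs,
      forall j, j < m -> holds phi a (projT2 Mb j, r j).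
  have [m' mm' /independent_enum[M [b [MT Hb]]]] := unb m.
  exists (existT _ M b); split=> // r; have [a Ha] := Hb r.
  by exists a => j jm; apply: Ha; apply: leq_trans jm mm'.
have [Mb HMb] := choice exM.
have [U [UU evU]] := ultraFilterLemma eventually_filter.
pose M m := projT1 (Mb m).
pose b j : tup (ultraproduct U M) ys :=
  tclass (@ultra_class _ U L M) (fun m => projT2 (Mb m) j).
exists (ultraproduct U M), b; split.
  by apply: ultraproduct_models => m; apply: (HMb m).1.
move=> r; pose a m := projT1 (cid ((HMb m).2 r)).
have Ha m j : j < m -> holds phi (a m) (projT2 (Mb m) j, r j).
  exact: (projT2 (cid ((HMb m).2 r))).
exists (tclass (@ultra_class _ U L M) a) => j; rewrite /holds /= /b tclass_cat.
apply/(Los UU _ (fun m => tcat (a m) (projT2 (Mb m) j)) (ultraproductP UU M)).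
(* Condition [j] is guaranteed only in factors of index above [j]. *)
by apply: evU; exists j.+1 => // m /= jm; apply: Ha.
Qed.

(** That some m members of the predicate, with given signs, isolate m + 1 listed instances is one
    formula of the expanded language. Transferred to (M; B), it contradicts independence by
    pigeonhole. *)
Lemma no_isolated_extension (L : language) (T : set (sentence L))
    (xs ys : seq (lsort L)) (phi : formula L (xs ++ ys)) (M N : structure L)
    (b : nat -> tup M ys) (f : forall s, M s -> N s) (p' : set (instance ys N)) :
  (forall r : nat -> bool, exists a : tup M xs,
     forall j, holds phi a (b j, r j)) ->
  elementary_phi_extension T phi (range b) (phi_set (range b) (fun=> true)) f p' ->
  phi_isolated T phi p' -> False.
Proof.
move=> indb [[_ cons'] sub' [B' [elB domB']]] [p0 [fin0 sub0 ent0]].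
have [l0 l0P] := finite_set_list fin0.
have [N2 [g [a2 [[N2T elg] _]]]] := cons'.
have NT : models N T := elementary_models elg N2T.
(* One instance more than [l0] has, so that some index escapes any [m] witnesses. *)
pose m := size l0; pose z := [seq (b j, true) | j <- iota 0 m.+1].
have [c [e [vs zE]]] := name_params z.
pose L' := language_pred ys.
pose phi' : formula L' (xs ++ ys) := expand ys phi.
have holdsE (K : structure L) (B : set (tup K ys)) (a : tup K xs) i :
    @holds L' xs ys phi' (structure_pred B) a i <-> holds phi a i.
  rewrite /holds /phi'; case: i => y [] /=; first exact: sat_expand.
  by split=> H H'; apply: H; move: H'; rewrite sat_expand.
have allE (K : structure L) (B : set (tup K ys)) (a : tup K xs) l :
    all_prop (@holds L' xs ys phi' (structure_pred B) a) l <->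
    all_prop (holds phi a) l by apply: all_prop_iff => i; apply: holdsE.
have : @sat L' (structure_pred B') c
    (@Fisol L' xs ys phi' (Fpred ys) c (map snd l0) [::] vs) (tmap f e).
  apply/sat_isol; exists l0; split=> //=.
  - apply/l0P => i p0i; apply/sat_pred/domB'.
    by exists i => //; apply: sub0.
  - have [|a Ha] := consistent_finite (l := l0) cons'; first exact/l0P.
    by exists a; apply/allE/all_prop_catrev; split.
  - move=> a /allE/all_prop_catrev[/l0P Ha _]; apply/allE.
    rewrite (pull_instance_map f) -zE all_prop_map all_prop_map.
    (* [N] with the identity is a model of its own diagram, so the entailment applies to solutions
       in [N] itself. *)
    have ra : realizes phi (fun s x => x) a p0.
      by move=> i /Ha; rewrite tmap_id.
    have rj j : holds phi a (tmap f (b j), true).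
      have := ent0 N _ a (conj NT (@elementary_id _ N)) ra (tmap f (b j), true).
      rewrite tmap_id; apply; apply: sub'.
      by exists (b j, true) => //; exists (b j) => //; exists j.
    by elim: (iota _ _) => //= j l IH; split=> //; apply: rj.
move=> /(elB c _ e)/sat_isol[l [lsz lB [a /allE/all_prop_catrev[Ha _]] Hz]].
have [js jsP] : exists js : seq nat, map fst l = map b js.
  elim: l lB {lsz Ha Hz} => [|i l IH]; first by exists [::].
  move=> [/(sat_pred (range b) i.1)[j _ E] /IH[js jsE]].
  by exists (j :: js); rewrite /= E jsE.
have [j0 j0m j0js] : exists2 j, j \in iota 0 m.+1 & j \notin js.
  apply: contrapT => H; have : {subset iota 0 m.+1 <= js}.
    by move=> j jm; apply: contrapT => /negP nj; apply: H; exists j.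
  move=> /(uniq_leq_size (iota_uniq _ _)); rewrite size_iota.
  by rewrite -(size_map b js) -jsP size_map -(size_map snd l) lsz size_map ltnn.
(* The pattern copies [a] at every index other than [j0] and is negative at [j0]. So [a'] still
   solves [l], whose parameters avoid [j0], but fails a listed instance. *)
have [a' Ha'] := indb (fun j => (j != j0) && `[< holds phi a (b j, true) >]).
have Ha'l : all_prop (holds phi a') l.
  elim: l js jsP j0js Ha {lsz lB Hz} => [|[y t] l IH] [|j js] //= [-> lE].
  rewrite inE negb_or => /andP[j0j j0js] [Hy Hl]; split; last exact: IH lE _ Hl.
  have := Ha' j; rewrite eq_sym j0j /=; case: t Hy => Hy.
    by rewrite asboolT.
  by rewrite asboolF //; apply/(holds_neg phi a (b j) true).
have /allE : all_prop (@holds L' xs ys phi' (structure_pred (range b)) a')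
    [seq (pull e v.1, v.2) | v <- vs].
  by apply: Hz; apply/allE/all_prop_catrev; split.
rewrite -zE all_prop_map => /all_prop_mem /(_ j0m) Htrue.
have := Ha' j0; rewrite eqxx /=.
by move/(holds_neg phi a' (b j0) true); apply.
Qed.

Theorem theorem2p4 (L : language) (T : set (sentence L))
    (hT : complete_theory T) (xs ys : seq (lsort L))
    (phi : formula L (xs ++ ys)) :
  (dependent T phi <->
   (forall (M : structure L) (B : set (tup M ys)) (p : set (instance ys M)),
      models M T -> phi_type T phi B p ->
      exists (N : structure L) (f : forall s, M s -> N s)
             (p' : set (instance ys N)),
        elementary_phi_extension T phi B p f p' /\ phi_isolated T phi p')) /\
  (dependent T phi ->
   forall n : nat, ID_is T phi n ->
   forall (M : structure L) (B : set (tup M ys)) (p : set (instance ys M)),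
     models M T -> phi_type T phi B p ->
     exists (N : structure L) (f : forall s, M s -> N s)
            (p' : set (instance ys N)),
       [/\ elementary_phi_extension T phi B p f p',
           phi_isolated T phi p'
         & (phi_dom p' `\` [set tmap f b | b in B]) #<= `I_(2 * n)]).
Proof.
(* The bounded version comes first: it gives both the forward implication and the final clause. *)
have bounded n : ID_is T phi n ->
   forall (M : structure L) (B : set (tup M ys)) (p : set (instance ys M)),
     models M T -> phi_type T phi B p ->
     exists (N : structure L) (f : forall s, M s -> N s)
            (p' : set (instance ys N)),
       [/\ elementary_phi_extension T phi B p f p',
           phi_isolated T phi p'
         & (phi_dom p' `\` [set tmap f b | b in B]) #<= `I_(2 * n)].
  move=> [_ maxn] M B p MT [[s ->] cons_p].
  have sat_p (lb : seq (tup M ys)) : all_prop B lb ->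
      exists a : tup M xs, all_prop (holds phi a) (signed s lb).
    move=> Blb; apply: (consistent_finite cons_p); rewrite all_prop_map.
    by apply: all_prop_impl Blb => b Bb; exists b.
  have [k [F [lb [kn pF isoF]]]] := isolating_pair_filter MT sat_p maxn.
  have [N [f [p' [H1 H2 H3]]]] := isolated_extension MT pF isoF.
  exists N, f, p'; split=> //; apply: card_le_trans H3 _.
  by rewrite card_le_II leq_mul2l.
split; last by move=> _.
split=> [[n IDn] M B p MT pB|ext].
  by have [N [f [p' [H1 H2 _]]]] := bounded n IDn M B p MT pB; exists N, f, p'.
apply: contrapT => ndep; have [[M0 M0T] _] := hT.
have [M [b [MT indb]]] := independent_sequence
  (not_dependent_unbounded (has_independent0 phi M0T) ndep).
(* The all-positive type over the independent sequence serves as the counterexample. *)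
have [|N [f [p' [H1 H2]]]] := ext M (range b) (phi_set (range b) (fun=> true)) MT.
  split; first by exists (fun=> true).
  have [a Ha] := indb (fun=> true).
  by apply: (realized_consistent (a := a)) => // _ [_ [j _ <-] <-].
exact: no_isolated_extension indb H1 H2.
Qed.
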